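(* Let $V$ be an $n$-dimensional complex vector space, $\Lambda(V\otimes V^* )$ the exterior algebra on $V\otimes V^*$, and $X=(x_{ij})_{1\le i,j\le n}\in\operatorname{Mat}_{n,n}(\Lambda(V\otimes V^* ))$. Then $$nX^{2n-1}-\operatorname{tr}(X^1)X^{2n-2}-\operatorname{tr}(X^3)X^{2n-4}-\cdots-\operatorname{tr}(X^{2n-3})X^2-\operatorname{tr}(X^{2n-1})X^0=0,$$ i.e. $nX^{2n-1}-\sum_{k=0}^{n-1}\operatorname{tr}(X^{2k+1})X^{2n-2-2k}=0$, where $X^0$ is the identity matrix.
   Context: $e_1,\ldots,e_n$ is a basis of $V$, $e_i^*$ its dual basis, $x_{ij}=e_i\otimes e_j^*$ is the standard basis of $V\otimes V^*$. Products in the exterior algebra are wedge products; matrix products are taken with entries multiplied in the order written. *)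

(* Defs.v *)
(* Exterior (Grassmann) algebra over C = R[i] (R a realType),
   on the n^2-dimensional space V (x) V^* with basis x_ij = e_(i,j). *)
From HB Require Import structures.
From mathcomp Require Import all_boot all_order all_algebra.
From mathcomp Require Import complex.
From mathcomp Require Import reals.
Set Implicit Arguments. Unset Strict Implicit. Unset Printing Implicit Defensive.
Import Order.TTheory GRing.Theory Num.Theory.
Local Open Scope ring_scope.

(* Elements of the exterior algebra Lambda(W), W with basis indexed by the
   finite type I: coefficient vectors on the standard basis
   e_S = e_{s1} /\ ... /\ e_{sk} (s1 < ... < sk in the order enum_rank of I). *)
Definition ext (K : nzRingType) (I : finType) := {ffun {set I} -> K}.

(* sign of e_S /\ e_T = sign * e_{S u T} for disjoint S, T: (-1)^(inversions) *)
Definition ext_sign (K : nzRingType) (I : finType) (S T : {set I}) : K :=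
  (-1) ^+ #|[set p : I * I | [&& p.1 \in S, p.2 \in T &
                               (enum_rank p.2 < enum_rank p.1)%N]]|.

Definition ext_mul (K : nzRingType) (I : finType) (a b : ext K I) : ext K I :=
  [ffun U : {set I} => \sum_(S : {set I}) \sum_(T : {set I} |
      [disjoint S & T] && (S :|: T == U)) ext_sign K S T * a S * b T].

Definition ext_one (K : nzRingType) (I : finType) : ext K I :=
  [ffun S : {set I} => (S == set0)%:R].

Definition ext_gen (K : nzRingType) (I : finType) (i : I) : ext K I :=
  [ffun S : {set I} => (S == [set i])%:R].

Definition ext_mxmul (K : nzRingType) (I : finType) (n : nat)
  (A B : 'M[ext K I]_n) : 'M[ext K I]_n :=
  \matrix_(i < n, j < n) \sum_(k < n) ext_mul (A i k) (B k j).

Definition ext_mx1 (K : nzRingType) (I : finType) (n : nat) : 'M[ext K I]_n :=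
  \matrix_(i < n, j < n) (if i == j then ext_one K I else 0).

Definition ext_mxpow (K : nzRingType) (I : finType) (n : nat)
  (X : 'M[ext K I]_n) (k : nat) : 'M[ext K I]_n :=
  iter k (fun M => ext_mxmul M X) (ext_mx1 K I n).

Definition ext_tr (K : nzRingType) (I : finType) (n : nat)
  (A : 'M[ext K I]_n) : ext K I := \sum_(i < n) A i i.

Definition ext_lscale (K : nzRingType) (I : finType) (n : nat)
  (a : ext K I) (M : 'M[ext K I]_n) : 'M[ext K I]_n :=
  \matrix_(i < n, j < n) ext_mul a (M i j).

Definition LamVV (R : realType) (n : nat) := ext (R[i]) ('I_n * 'I_n)%type.

Definition genX (R : realType) (n : nat) : 'M[LamVV R n]_n :=
  \matrix_(i < n, j < n) ext_gen (R[i]) ((i, j) : ('I_n * 'I_n)%type).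

(* Main.v *)
(* Rosset: the entries of X^2 commute, and tr(X^(2k)) = 0 for k > 0 because odd
   elements anticommute; Newton's identities and Cayley-Hamilton then give
   X^(2n) = 0.  Applying the contraction d/dx_ij to the entry (i,b) of this
   equation and summing over i gives
     \sum_(k < 2n) (-1)^k tr(X^k) (X^(2n-1-k))_jb = 0,
   where the terms with k even and positive vanish: this is the identity. *)
Require Import Defs.
From HB Require Import structures.
From mathcomp Require Import all_boot all_order all_algebra.
From mathcomp Require Import complex.
From mathcomp Require Import reals.
From mathcomp Require Import ring zify.
Import Order.TTheory GRing.Theory Num.Theory.
Local Open Scope ring_scope.

Set Implicit Arguments.
Unset Strict Implicit.
Unset Printing Implicit Defensive.

(** * Nilpotency over a commutative ring from vanishing traces of powers *)

Lemma deriv_prod (R : comNzRingType) (I : finType) (F : I -> {poly R}) :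
  (\prod_i F i)^`() = \sum_i (F i)^`() * \prod_(j | j != i) F j.
Proof.
suff H (r : seq I) : uniq r -> (\prod_(i <- r) F i)^`() =
    \sum_(i <- r) (F i)^`() * \prod_(j <- r | j != i) F j.
  by rewrite H ?index_enum_uniq.
elim: r => [|x r IHr] /=; first by rewrite !big_nil derivC.
case/andP=> xr ur; rewrite !big_cons derivM IHr // eqxx /=; congr (_ * _ + _).
  rewrite big_seq [RHS]big_seq_cond; apply: eq_bigl => i.
  by case: (boolP (i \in r)) => //= ir; apply/esym/(memPn xr).
rewrite mulr_sumr !big_seq; apply: eq_bigr => i ir.
by rewrite big_cons eq_sym (memPn xr) // mulrCA.
Qed.

(** Jacobi's formula. By the product rule the derivative is a sum of determinants [\det (B i)] with
    only row [i] differentiated; expanding along that row leaves the cofactors of [A]. *)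
Lemma deriv_det (R : comNzRingType) (n : nat) (A : 'M[{poly R}]_n) :
  (\det A)^`() = \tr (map_mx (@deriv R) A *m \adj A).
Proof.
pose B i := \matrix_(k, l) (if k == i then (A k l)^`() else A k l).
have -> : (\det A)^`() = \sum_i \det (B i).
  rewrite /determinant exchange_big /= raddf_sum; apply: eq_bigr => s _.
  rewrite [LHS]derivM deriv_prod -[(-1) ^+ _](rmorph_sign polyC) /= derivC mul0r add0r mulr_sumr.
  apply: eq_bigr => i _; congr (_ * _).
  rewrite [RHS](bigD1 i) //= mxE eqxx; congr (_ * _).
  by apply: eq_bigr => j ji; rewrite mxE (negPf ji).
apply: eq_bigr => i _; rewrite (expand_det_row _ i) mxE; apply: eq_bigr => j _.
rewrite !mxE eqxx; congr (_ * (_ * \det _)).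
by apply/matrixP => k l; rewrite !mxE eq_sym (negPf (neq_lift _ _)).
Qed.

(* Multiplying t - A by Q = \sum_(k <= d) t^(d-k) A^k and taking the trace against
   its adjugate gives t^(d+1) p' - T = (n+1) t^d p with deg T < d, so the
   coefficients of p satisfy i p_i = (n+1) p_i. *)
Lemma expmx_eq0_of_mxtrace (R : comNzRingType) (n : nat) (A : 'M[R]_n) :
    (forall (x : R) m, x *+ m.+1 = 0 -> x = 0) ->
    (forall k, \tr (A ^+ k.+1) = 0) ->
  A ^+ n = 0.
Proof.
case: n A => [|n] A torsion_free trA; first exact: flatmx0.
set p := char_poly A; set J := \adj (char_poly_mx A).
have trJ : \tr J = p^`().
  rewrite /p /char_poly deriv_det -/J -[J in LHS]mul1mx; congr (\tr (_ *m _)).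
  by apply/matrixP => i j; rewrite !mxE derivB derivC subr0 derivMn derivX.
(* A uniform size bound for the adjugate entries. [T] combines these with constant coefficients
   only, so it obeys the same bound. *)
pose d := \max_i \max_j size (J i j).
have szJ i j : (size (J i j) <= d)%N.
  exact: leq_trans (leq_bigmax j) (leq_bigmax (F := fun i => \max_j size (J i j)) i).
pose T := \tr (J *m map_mx polyC (A ^+ d.+1)).
have szT : (size T <= d)%N.
  apply: (leq_trans (size_sum _ _ _)); apply/bigmax_leqP => i _.
  rewrite mxE; apply: (leq_trans (size_sum _ _ _)); apply/bigmax_leqP => j _.
  rewrite [X in _ * X]mxE mulrC mul_polyC; apply: leq_trans (szJ i j); exact: size_scale_leq.
pose a := map_mx polyC A.
pose Q := \sum_(k < d.+1) 'X%:M ^+ (d - k) * a ^+ k.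
have trQ : \tr Q = 'X^d *+ n.+1.
  rewrite /Q big_ord_recl /= linearD /= expr0 mulr1 subn0 -rmorphXn /= mxtrace_scalar.
  rewrite linear_sum big1 ?addr0 // => k _.
  rewrite -rmorphXn /= -rmorphXn /= -mulmxE mul_scalar_mx linearZ /=.
  by rewrite (trace_map_mx polyC) trA rmorph0 mulr0.
have comXa : GRing.comm ('X%:M : 'M[{poly R}]_n.+1) a.
  by rewrite /GRing.comm -mulmxE scalar_mxC.
have key : 'X^(d.+1) * p^`() - T = ('X^d * p) *+ n.+1 :> {poly R}.
  have : (char_poly_mx A) * Q = 'X%:M ^+ d.+1 - a ^+ d.+1.
    by rewrite subrXX_comm.
  move/(congr1 (fun M => \tr (J *m M))).
  rewrite -mulmxE mulmxA mul_adj_mx mul_scalar_mx linearZ /= trQ -/p.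
  rewrite mulmxBr linearB /= -rmorphXn /= -rmorphXn /= mul_mx_scalar linearZ /= trJ -/T => <-.
  by rewrite mulrnAr mulrC.
(* Compare coefficients of degree [d + i], which [T] does not reach. For [i = 0] the factor
   ['X^(d.+1)] makes the left side vanish. *)
have coefp i : p`_i *+ i = p`_i *+ n.+1.
  have /(congr1 (fun q : {poly R} => q`_(d + i))) := key.
  rewrite coefB (nth_default _ (leq_trans szT (leq_addr _ _))) subr0.
  rewrite coefMn !coefXnM (ltnNge _ d) leq_addr /= addKn => <-.
  case: i => [|i]; first by rewrite addn0 ltnSn.
  by rewrite addnS ltnS ltnNge leq_addr /= subSS addKn coef_deriv.
have pX : p = 'X^(n.+1).
  apply/polyP => i; rewrite coefXn; case: (ltngtP i n.+1) => [lt_in|gt_in|->].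
  - apply: (torsion_free _ (n - i)%N).
    (* Subtracting the two sides of [coefp] leaves the multiple [n.+1 - i = (n - i).+1] of the
       coefficient. *)
    by rewrite -subSn // mulrnBr ?(ltnW lt_in) // coefp subrr.
  - by rewrite nth_default // size_char_poly.
  - by have /monicP := char_poly_monic A; rewrite lead_coefE size_char_poly.
have := Cayley_Hamilton A; rewrite -/p pX rmorphXn /= horner_mx_X; exact.
Qed.

(* An alias of [ext], since [{ffun _ -> _}] already carries the pointwise product. *)
Definition grassmann (K : comNzRingType) (I : finType) : Type := ext K I.

HB.instance Definition _ (K : comNzRingType) (I : finType) :=
  GRing.Zmodule.copy (grassmann K I) (ext K I).

(** * Signs and ring axioms of the wedge product *)

Section Grassmann.
Variables (K : comNzRingType) (I : finType).
Local Notation sgn := (@ext_sign K I).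
Implicit Types (S T U : {set I}) (a b c : grassmann K I) (i j : I).

(** As a product over pairs, the sign is visibly multiplicative in each argument over disjoint
    unions. *)
Lemma ext_signE S T :
  sgn S T = \prod_(s in S) \prod_(t in T) (-1) ^+ (enum_rank t < enum_rank s)%N.
Proof.
rewrite /ext_sign pair_big /= -prodr_const big_mkcond /= [RHS]big_mkcond /=.
apply: eq_bigr => -[s t] _ /=; rewrite inE /=.
by case: (s \in S) (t \in T) => [] [] //=; case: (_ < _)%N.
Qed.

Lemma ext_signUl S T U :
  [disjoint S & T] -> sgn (S :|: T) U = sgn S U * sgn T U.
Proof.
by move=> dST; rewrite !ext_signE -bigU //=; apply: eq_bigl => s; rewrite !inE.
Qed.

Lemma ext_signUr S T U :
  [disjoint T & U] -> sgn S (T :|: U) = sgn S T * sgn S U.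
Proof.
move=> dTU; rewrite !ext_signE -big_split /=; apply: eq_bigr => s _.
by rewrite -bigU //=; apply: eq_bigl => t; rewrite !inE.
Qed.

Lemma ext_sign0s S : sgn set0 S = 1.
Proof. by rewrite ext_signE big_set0. Qed.

Lemma ext_signs0 S : sgn S set0 = 1.
Proof. by rewrite ext_signE big1 // => s _; rewrite big_set0. Qed.

(** For disjoint sets, each pair is an inversion in exactly one of the two orders, so it contributes
    one factor [-1]. *)
Lemma ext_signC S T :
  [disjoint S & T] -> sgn S T = (-1) ^+ (#|S| * #|T|)%N * sgn T S.
Proof.
move=> dST; rewrite !ext_signE [in RHS]exchange_big /= mulnC exprM -!prodr_const -big_split.
apply: eq_bigr => s sS; rewrite -big_split /=; apply: eq_bigr => t tT.
have st : s != t by apply: contraTneq tT => <-; rewrite (disjointFr dST sS).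
case: (ltngtP (enum_rank t) (enum_rank s)) => /=; rewrite ?mulr1 ?mulN1r ?opprK //.
by move/val_inj/enum_rank_inj/eqP; rewrite eq_sym (negPf st).
Qed.

(** [S] determines its partner as the complement in [U], which leaves a single sum. *)
Lemma ext_mulE a b U :
  ext_mul a b U = \sum_(S : {set I} | S \subset U) sgn S (U :\: S) * a S * b (U :\: S).
Proof.
rewrite ffunE [RHS]big_mkcond; apply: eq_bigr => S _; case: ifP => [sSU | nSU].
  rewrite (big_pred1 (U :\: S)) // => T; apply/andP/eqP => [[dST /eqP<-] | ->].
    by rewrite setDUl setDv set0U; apply/esym/setDidPl; rewrite disjoint_sym.
  rewrite -setI_eq0 setIDA setDIl setDv set0I eqxx /=.
  by rewrite -{1}(setIidPr sSU) setID.
rewrite big_pred0 // => T; apply/negP => /andP[_ /eqP UE].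
by rewrite -UE subsetUl in nSU.
Qed.

Lemma ext_mul1l : left_id (@ext_one K I : grassmann K I) (@ext_mul K I).
Proof.
move=> a; apply/ffunP => U; rewrite ext_mulE (bigD1 set0) ?sub0set //= big1.
  by rewrite ffunE eqxx ext_sign0s setD0 !mul1r addr0.
by move=> S /andP[_ /negPf nS0]; rewrite ffunE nS0 mulr0 mul0r.
Qed.

Lemma ext_mul1r : right_id (@ext_one K I : grassmann K I) (@ext_mul K I).
Proof.
move=> a; apply/ffunP => U; rewrite ext_mulE (bigD1 U) //= big1.
  by rewrite setDv ffunE eqxx ext_signs0 mul1r mulr1 addr0.
move=> S /andP[sSU nSU]; rewrite [ext_one _ _ _]ffunE setD_eq0.
by rewrite [_ \subset _](contraNF _ nSU) ?mulr0 // => sUS; rewrite eqEsubset sSU.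
Qed.

Lemma ext_mulDl : left_distributive (@ext_mul K I) (+%R : grassmann K I -> _).
Proof.
move=> a b c; apply/ffunP => U; rewrite ext_mulE [RHS]ffunE !ext_mulE -big_split /=.
by apply: eq_bigr => S _; rewrite ffunE mulrDr mulrDl.
Qed.

Lemma ext_mulDr : right_distributive (@ext_mul K I) (+%R : grassmann K I -> _).
Proof.
move=> a b c; apply/ffunP => U; rewrite ext_mulE [RHS]ffunE !ext_mulE -big_split /=.
by apply: eq_bigr => S _; rewrite ffunE mulrDr.
Qed.

(** Both sides become sums over chains of sets [S], [P], [U], with blocks [S], [P :\: S], [U :\: P].
    Either bracketing yields the product of the three pairwise signs of these blocks. *)
Lemma ext_mulA : associative (@ext_mul K I : _ -> _ -> grassmann K I).
Proof.
move=> a b c; apply/ffunP => U; rewrite !ext_mulE.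
pose F S T := sgn S (U :\: S) * sgn T ((U :\: S) :\: T)
                * a S * b T * c ((U :\: S) :\: T).
transitivity (\sum_(S : {set I} | S \subset U)
                \sum_(P : {set I} | (P \subset U) && (S \subset P)) F S (P :\: S)).
  apply: eq_bigr => S sSU; rewrite ext_mulE mulr_sumr.
  rewrite (reindex_onto (fun P : {set I} => P :\: S) (fun T => S :|: T)) /=; last first.
    move=> T sT; rewrite setDUl setDv set0U; apply/setDidPl.
    by move: sT; rewrite subsetD => /andP[].
  apply: eq_big => [P | P _]; last by rewrite /F; ring.
  apply/andP/andP => [[sPU /eqP SP] | [sPU sSP]].
    rewrite -SP subsetUl subUset sSU; split=> //.
    by apply: subset_trans sPU _; rewrite subsetDl.
  by rewrite setSD // -{1}(setIidPr sSP) setID.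
rewrite (exchange_big_dep (fun P : {set I} => P \subset U)) /=; last by move=> S P _ /andP[].
apply: eq_bigr => P sPU; rewrite ext_mulE mulr_sumr mulr_suml.
apply: eq_big => [S | S /and3P[sSU _ sSP]].
  by rewrite sPU; apply/andP/idP => [[]|sSP] //; rewrite (subset_trans sSP).
have dSP : [disjoint S & P :\: S] by rewrite disjoint_sym disjoints_subset subsetDr.
have dPU : [disjoint P :\: S & U :\: P].
  by apply: disjointWl (subsetDl P S) _; rewrite disjoint_sym disjoints_subset subsetDr.
have PE : P = S :|: P :\: S by rewrite -{1}(setIidPr sSP) setID.
have UE : U :\: S = (P :\: S) :|: (U :\: P).
  apply/setP => x; rewrite !inE.
  have /implyP := subsetP sSP x; have /implyP := subsetP sPU x.
  by case: (x \in S); case: (x \in P); case: (x \in U).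
rewrite /F setDDl -PE UE (ext_signUr _ dPU).
have -> : sgn P (U :\: P) = sgn S (U :\: P) * sgn (P :\: S) (U :\: P).
  by rewrite -ext_signUl // -PE.
ring.
Qed.

End Grassmann.

Section GrassmannRing.
Variables (K : comNzRingType) (I : finType).

Fact ext_one_neq0 : (ext_one K I : grassmann K I) != 0.
Proof.
by apply/eqP => /ffunP/(_ set0)/eqP; rewrite !ffunE eqxx oner_eq0.
Qed.

HB.instance Definition _ := GRing.Zmodule_isNzRing.Build (grassmann K I)
  (@ext_mulA K I) (@ext_mul1l K I) (@ext_mul1r K I)
  (@ext_mulDl K I) (@ext_mulDr K I) ext_one_neq0.
End GrassmannRing.

(** * The grading by parity and graded commutativity *)

Section Parity.
Variables (K : comNzRingType) (I : finType).
Local Notation sgn := (@ext_sign K I).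
Implicit Types (S T U : {set I}) (a b : grassmann K I) (i j : I) (p q : bool).

(** A predicate rather than a parity function: zero has both parities and mixed elements have
    none. *)
Definition has_parity p a := [forall S : {set I}, (odd #|S| == p) || (a S == 0)].

Lemma has_parityP p a :
  reflect (forall S, odd #|S| != p -> a S = 0) (has_parity p a).
Proof.
apply: (iffP forallP) => [H S nS | H S].
  by have := H S; rewrite (negPf nS) => /eqP.
by case: eqP => //= /eqP nS; apply/eqP/H.
Qed.

Lemma has_parityB p a b : has_parity p a -> has_parity p b -> has_parity p (a - b).
Proof.
move=> /has_parityP Ha /has_parityP Hb; apply/has_parityP => S nS.
by rewrite !ffunE Ha // Hb // subr0.
Qed.

Lemma has_parity0 p : has_parity p (0 : grassmann K I).
Proof. by apply/has_parityP => S _; rewrite ffunE. Qed.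

Lemma has_parity_sum p (J : finType) (F : J -> grassmann K I) :
  (forall k, has_parity p (F k)) -> has_parity p (\sum_k F k).
Proof.
move=> HF; elim/big_ind: _ => // [|a b Ha Hb]; first exact: has_parity0.
(* Closure is known for differences, so the sum is written [a - (0 - b)]. *)
by rewrite -[b]opprK -[- b]sub0r; do 2?apply: has_parityB => //; apply: has_parity0.
Qed.

Lemma has_parity1 : has_parity false (1 : grassmann K I).
Proof.
apply/has_parityP => S nS; rewrite ffunE; case: eqP => [SE|_].
  by rewrite SE cards0 in nS.
by rewrite mulr0n.
Qed.

Lemma has_parity_gen i : has_parity true (ext_gen K i : grassmann K I).
Proof.
apply/has_parityP => S nS; rewrite ffunE; case: eqP => [SE|_].
  by rewrite SE cards1 in nS.
by rewrite mulr0n.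
Qed.

Lemma has_parityM p q a b :
  has_parity p a -> has_parity q b -> has_parity (p (+) q) (a * b).
Proof.
move=> /has_parityP Ha /has_parityP Hb; apply/has_parityP => U nU.
rewrite [LHS]ext_mulE big1 // => S sSU.
have [oS|/Ha->] := eqVneq (odd #|S|) p; last by rewrite mulr0 mul0r.
rewrite Hb ?mulr0 //; apply: contraNneq nU => oT.
by rewrite -(cardsID S U) (setIidPr sSU) oddD oS oT.
Qed.

(** Swapping the factors exchanges [S] with its complement in [U]; [ext_signC] then gives a sign
    that depends only on the parities of the two cardinals. *)
Lemma mulC_parity p q a b :
  has_parity p a -> has_parity q b -> a * b = (-1) ^+ (p && q) * (b * a).
Proof.
move=> /has_parityP Ha /has_parityP Hb; rewrite mulr_sign; apply/ffunP => U.
transitivity ((-1) ^+ (p && q) * ((b * a : grassmann K I) U)); last first.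
  by rewrite mulr_sign; case: (p && q) => //=; rewrite [RHS]ffunE.
rewrite [LHS]ext_mulE [X in _ * X]ext_mulE mulr_sumr.
rewrite (reindex_onto (fun S => U :\: S) (fun S => U :\: S)) /=; last first.
  by move=> S sSU; rewrite setDDr setDv set0U; apply/setIidPr.
apply: eq_big => [S | S /andP[_ /eqP SE]].
  rewrite subsetDl /= setDDr setDv set0U; apply/eqP/idP => [<-|/setIidPr //].
  exact: subsetIl.
rewrite SE.
have [oS|/Hb->] := eqVneq (odd #|S|) q; last by rewrite !(mulr0, mul0r).
have [oT|/Ha->] := eqVneq (odd #|U :\: S|) p; last by rewrite !(mulr0, mul0r).
rewrite ext_signC; last by rewrite disjoints_subset subsetDr.
rewrite -signr_odd oddM oS oT; ring.
Qed.

End Parity.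

(** * The even part as a commutative ring *)

Section EvenPart.
Variables (K : comNzRingType) (I : finType).

Definition even_part : {pred grassmann K I} := has_parity false.

Fact even_part_subring : subring_closed even_part.
Proof.
split=> [|a b|a b]; first exact: has_parity1.
  exact: has_parityB.
exact: has_parityM.
Qed.

HB.instance Definition _ := GRing.isSubringClosed.Build (grassmann K I) even_part
  even_part_subring.

(** A separate type allows a commutative ring instance, over which determinants and Cayley-Hamilton
    are available. *)
Record even_grassmann := EvenGrassmann {
  even_val : grassmann K I; even_valP : even_val \in even_part }.

HB.instance Definition _ := [isSub for even_val].
HB.instance Definition _ := [Choice of even_grassmann by <:].
HB.instance Definition _ := [SubChoice_isSubNzRing of even_grassmann by <:].

Fact even_grassmann_mulC : @commutative even_grassmann _ *%R.
Proof.
move=> a b; apply: val_inj; rewrite !rmorphM /=.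
by rewrite (mulC_parity (even_valP a) (even_valP b)) mul1r.
Qed.

HB.instance Definition _ :=
  GRing.PzRing_hasCommutativeMul.Build even_grassmann even_grassmann_mulC.
End EvenPart.

(** * Powers and traces of matrices with odd entries *)

Section OddMatrices.
Variables (K : numDomainType) (I : finType) (n : nat).
Implicit Types (A B X : 'M[grassmann K I]_n).

Lemma grassmann_torsion_free (a : grassmann K I) m : a *+ m.+1 = 0 -> a = 0.
Proof.
move/ffunP => a0; apply/ffunP => S; have /eqP := a0 S.
by rewrite ffunMnE [X in _ == X]ffunE mulrn_eq0 /= => /eqP->; rewrite ffunE.
Qed.

Lemma mxtrace_mulC_odd A B :
    (forall i j, has_parity true (A i j)) -> (forall i j, has_parity true (B i j)) ->
  \tr (A *m B) = - \tr (B *m A).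
Proof.
move=> oddA oddB; rewrite /mxtrace -sumrN.
under eq_bigr do rewrite mxE; rewrite exchange_big; apply: eq_bigr => j _.
rewrite mxE -sumrN; apply: eq_bigr => i _.
by rewrite (mulC_parity (oddA i j) (oddB j i)) mulN1r.
Qed.

Lemma has_parity_expmx X :
    (forall i j, has_parity true (X i j)) ->
  forall m i j, has_parity (odd m) ((X ^+ m) i j).
Proof.
move=> oddX; elim=> [|m IHm] i j.
  rewrite expr0 mxE; case: (i == j); last exact: has_parity0.
  exact: has_parity1.
rewrite exprS mxE /= -addTb; apply: has_parity_sum => k.
exact: has_parityM.
Qed.

Lemma mxtrace_expmx_even X k :
  (forall i j, has_parity true (X i j)) -> \tr (X ^+ (2 * k.+1)) = 0.
Proof.
(* It suffices that twice the trace is zero. Splitting off one factor [X] on the left or on the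
   right gives the same power, while swapping two odd matrices negates the trace. *)
move=> oddX; rewrite mulnS; apply: (@grassmann_torsion_free _ 1).
have oddX' i j : has_parity true ((X ^+ (1 + 2 * k)) i j).
  by have := has_parity_expmx oddX (1 + 2 * k) i j; rewrite oddD oddM.
rewrite -[X in _ = X](addNr (\tr (X ^+ (1 + 2 * k) *m X))) -mxtrace_mulC_odd //.
by rewrite mulmxE -exprS -exprSr.
Qed.

Theorem expmx_odd_eq0 X :
  (forall i j, has_parity true (X i j)) -> X ^+ (2 * n) = 0.
Proof.
move=> oddX; rewrite exprM.
(* [Y] is [X ^+ 2] lifted to the commutative even part. Torsion-freeness and the vanishing traces
   transfer to it through the injective [val]. *)
pose Y : 'M[even_grassmann K I]_n :=
  \matrix_(i, j) EvenGrassmann (has_parity_expmx oddX 2 i j).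
have YE k : map_mx val (Y ^+ k) = (X ^+ 2) ^+ k.
  elim: k => [|k IHk]; first by rewrite !expr0 map_mx1.
  rewrite !(exprS _ k) map_mxM IHk; congr (_ *m _).
  by apply/matrixP => i j; rewrite mxE [Y i j]mxE.
rewrite -YE expmx_eq0_of_mxtrace ?map_mx0 // => [x m x0 | k].
  apply: val_inj; apply: (@grassmann_torsion_free _ m).
  by rewrite -raddfMn x0 raddf0.
by apply: val_inj; rewrite -trace_map_mx YE -exprM mxtrace_expmx_even //.
Qed.
End OddMatrices.

(** * Contraction by a dual basis vector *)

Section Contraction.
Variables (K : comNzRingType) (I : finType).
Local Notation sgn := (@ext_sign K I).
Implicit Types (S : {set I}) (a b : grassmann K I) (i j : I).

(** The left interior product: the sign brings the generator [i] to the front of each monomial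
    before it is removed. *)
Definition contract i a : grassmann K I :=
  [ffun S : {set I} => if i \in S then 0 else sgn [set i] S * a (i |: S)].

Fact contract_is_zmod_morphism i : zmod_morphism (contract i).
Proof.
move=> a b; apply/ffunP => S; rewrite !ffunE.
by case: ifP => _; rewrite ?subr0 // mulrBr.
Qed.

HB.instance Definition _ i :=
  GRing.isZmodMorphism.Build (grassmann K I) (grassmann K I) (contract i)
    (contract_is_zmod_morphism i).

Lemma ext_gen_mulE j b S :
  ((ext_gen K j : grassmann K I) * b) S =
    if j \in S then sgn [set j] (S :\ j) * b (S :\ j) else 0.
Proof.
rewrite [LHS]ext_mulE; case: ifPn => jS.
  rewrite (bigD1 [set j]) ?sub1set //= big1 => [|T /andP[_ /negPf nT]].
    by rewrite ffunE eqxx mulr1 addr0.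
  by rewrite ffunE nT mulr0 mul0r.
rewrite big1 // => T sTS; rewrite ffunE; case: eqP sTS => [->|_ _].
  by rewrite sub1set (negPf jS).
by rewrite mulr0 mul0r.
Qed.

Lemma ext_signK S T : sgn S T * sgn S T = 1.
Proof. by rewrite -expr2 sqrr_sign. Qed.

(** The antiderivation rule for one generator on the left; this suffices for powers of [X], which
    are unfolded from the left. *)
Lemma contract_gen_mul i j b :
  contract i ((ext_gen K j : grassmann K I) * b) =
    (if i == j then b else 0) - (ext_gen K j : grassmann K I) * contract i b.
Proof.
apply/ffunP => S.
rewrite [LHS]ffunE [RHS]ffunE [X in _ = _ + X]ffunE !ext_gen_mulE [contract i b _]ffunE.
rewrite !inE [j == i]eq_sym; case: (boolP (i \in S)) => iS; case: (eqVneq i j) => [<-|nij] /=.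
- by rewrite iS setD1K // mulrA ext_signK mul1r subrr.
- by rewrite ffunE; case: ifP => _; rewrite ?mulr0 subr0.
- by rewrite (negPf iS) setU1K // mulrA ext_signK mul1r subr0.
rewrite ffunE sub0r; case: ifPn => jS; last by rewrite mulr0 oppr0.
(* Here [i] is outside [S] and [j] inside. Isolating both generators leaves the signs of [(i, j)]
   and [(j, i)], whose product is the required [-1]. *)
have SE : S = [set j] :|: S :\ j by rewrite setD1K.
have UE : (i |: S) :\ j = [set i] :|: S :\ j.
  by rewrite setDUl; congr (_ :|: _); apply/setDidPl; rewrite disjoints1 inE.
have dj : [disjoint [set j] & S :\ j] by rewrite disjoints1 !inE eqxx.
have di : [disjoint [set i] & S :\ j] by rewrite disjoints1 !inE (negPf iS) andbF.
have dij : [disjoint [set i] & [set j]] by rewrite disjoints1 inE.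
rewrite UE [in sgn [set i] S]SE !ext_signUr // (ext_signC K dij) !cards1.
rewrite expr1 mulN1r -[RHS]mul1r -{1}(ext_signK [set j] [set i]).
ring.
Qed.
End Contraction.

(** Leibniz rule along a path of matrix indices: removing the factor after the first [k] costs
    [(-1) ^+ k] and cuts the path into one ending at [i] and one starting at [j]. *)
Lemma contract_expmx_gen (K : comNzRingType) (n : nat) (i j a b : 'I_n) m :
  let X : 'M[grassmann K ('I_n * 'I_n)%type]_n := \matrix_(i, j) ext_gen K (i, j) in
  contract (i, j) ((X ^+ m) a b) =
    \sum_(k < m) (-1) ^+ k * ((X ^+ k) a i * (X ^+ (m.-1 - k)) j b).
Proof.
move=> X; elim: m a => [|m IHm] a.
  (* Entries of the identity live on the empty set, whereas contraction reads only coefficients at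
     sets containing [(i, j)]. *)
  rewrite big_ord0 expr0 mxE; apply/ffunP => S; rewrite !ffunE; case: (boolP (_ \in S)) => // iS.
  case: (a == b); rewrite !ffunE ?mulr0 //.
  have /negPf-> : (i, j) |: S != set0 by apply/set0Pn; exists (i, j); rewrite setU11.
  by rewrite mulr0.
rewrite exprS mxE raddf_sum big_ord_recl /= expr0 mul1r subn0 mxE.
under eq_bigr do rewrite [X _ _]mxE contract_gen_mul IHm.
rewrite big_split /=; congr (_ + _).
  rewrite (bigD1 j) //= big1 => [|c /negPf nc].
    by rewrite xpair_eqE eqxx andbT addr0 eq_sym; case: (a == i); rewrite ?mul1r ?mul0r.
  by rewrite xpair_eqE [j == c]eq_sym nc andbF.
under [RHS]eq_bigr => k _.
  rewrite /bump /= add1n subnS [in X ^+ k.+1]exprS [X in _ * (X * _)]mxE mulr_suml mulr_sumr.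
  over.
rewrite exchange_big /=; apply: eq_bigr => c _; rewrite mulr_sumr -sumrN.
apply: eq_bigr => k _; rewrite mxE exprS mulN1r mulNr; congr (- _).
by rewrite !mulrA (commr_sign _ k) predn_sub.
Qed.

(** * The trace identity and its transfer to the stated operations *)

Lemma sum_even_odd (V : nmodType) (F : nat -> V) (n : nat) :
  \sum_(k < 2 * n) F k = \sum_(k < n) F (2 * k)%N + \sum_(k < n) F (2 * k + 1)%N.
Proof.
elim: n => [|n IHn]; first by rewrite !big_ord0 addr0.
rewrite mulnS !addSn add0n !big_ord_recr /= IHn addn1 -!addrA; congr (_ + _).
by rewrite addrCA.
Qed.

Theorem grassmann_mxtrace_identity (K : numDomainType) (n : nat) :
  let X : 'M[grassmann K ('I_n * 'I_n)%type]_n := \matrix_(i, j) ext_gen K (i, j) in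
  forall j b,
  (X ^+ (2 * n - 1)) j b *+ n
    = \sum_(k < n) \tr (X ^+ (2 * k + 1)) * (X ^+ (2 * n - 2 - 2 * k)) j b.
Proof.
(* Size zero has no row index. In size [n.+1] none of the subtractions in the exponents
   truncates. *)
case: n => [|n] X j b; first by case: j.
have oddX i k : has_parity true (X i k) by rewrite mxE; apply: has_parity_gen.
(* Using [i] both as row and in the contracted generator turns the left pieces into diagonal
   entries, which sum to traces. *)
have : \sum_i contract (i, j) ((X ^+ (2 * n.+1)) i b) = 0.
  by rewrite expmx_odd_eq0 // big1 // => i _; rewrite mxE raddf0.
under eq_bigr do rewrite contract_expmx_gen.
rewrite exchange_big /=.
under eq_bigr do rewrite -mulr_sumr -mulr_suml.
rewrite (sum_even_odd (fun k => (-1) ^+ k * (\tr (X ^+ k) * (X ^+ ((2 * n.+1).-1 - k)) j b))).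
(* Among the even exponents only zero survives; the trace of the identity supplies the factor
   [n.+1]. *)
rewrite big_ord_recl /= big1 => [|k _]; last first.
  by rewrite mxtrace_expmx_even ?mul0r ?mulr0.
rewrite muln0 !expr0 mul1r mxtrace_scalar subn0 addr0 mulr_natl subn1.
(* The odd terms all carry the sign [-1], which cancels when they change sides. *)
move/eqP; rewrite addr_eq0 => /eqP ->; rewrite -sumrN; apply: eq_bigr => k _.
rewrite exprD exprM sqrrN !expr1n mul1r expr1 mulN1r opprK.
by congr (_ * (X ^+ _) j b); lia.
Qed.

(** Bridge to the ring of matrices over [grassmann]. [ext_mxpow] appends factors on the right, hence
    [exprSr]. *)
Lemma ext_mxpowE (K : comNzRingType) (I : finType) (n : nat)
    (X : 'M[grassmann K I]_n) (k : nat) :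
  ext_mxpow X k = X ^+ k.
Proof.
elim: k => [|k IHk]; first by apply/matrixP => i j; rewrite !mxE; case: (i == j).
rewrite exprSr -IHk /ext_mxpow iterS; apply/matrixP => i j.
by rewrite [LHS]mxE [RHS]mxE.
Qed.

Unset Implicit Arguments.

Theorem theorem2p1 (R : realType) (n : nat) :
  let X := genX R n in
  let P := ext_mxpow X in
  P (2 * n - 1)%N *+ n
  - \sum_(k < n) ext_lscale (ext_tr (P (2 * k + 1)%N)) (P (2 * n - 2 - 2 * k)%N)
  = 0.
Proof.
move=> X P; apply/eqP; rewrite subr_eq0; apply/eqP/matrixP => j b.
have PE k : P k = (X : 'M[grassmann R[i] _]_n) ^+ k by exact: ext_mxpowE.
rewrite mulmxnE summxE PE; apply: etrans (grassmann_mxtrace_identity _ j b) _.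
by apply: eq_bigr => k _; rewrite !PE [RHS]mxE.
Qed.
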